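(* Let $p$ be a prime number, let $C$ be a commutative ring, let $A$ be a commutative $C$-algebra, and let $Ш_C(A)$ be the free Baxter $C$-algebra on $A$ of weight $1$. If $a^p\equiv a \pmod p$ for all $a\in A$, then $a^p\equiv a\pmod p$ for all $a\in Ш_C(A)$. In particular, taking $C=A=\mathbb{F}_p$, one has $a^p=a$ for all $a\in Ш_{\mathbb{F}_p}(\mathbb{F}_p)$.
   Context: Rings and algebras have an identity $1$. For an algebra $B$ and $a,b\in B$, $a\equiv b\pmod p$ means $a-b\in pB$. A Baxter $C$-algebra of weight $\lambda\in C$ is a pair $(R,P)$ where $R$ is a $C$-algebra and $P:R\to R$ is $C$-linear with $P(x)P(y)=P(xP(y))+P(P(x)y)+\lambda P(xy)$ for all $x,y\in R$. The free (commutative) Baxter $C$-algebra of weight $\lambda$ on a commutative $C$-algebra $A$, written $Ш_C(A)$, is realized as the mixable shuffle Baxter algebra: as a $C$-module it is $\bigoplus_{n\ge1}A^{\otimes n}$ (tensor products over $C$); its multiplication $\diamond$ is the $C$-bilinear product given recursively by $a_0\diamond(b_0\otimes b_1\otimes\cdots\otimes b_n)=a_0b_0\otimes b_1\otimes\cdots\otimes b_n$, $(a_0\otimes a_1\otimes\cdots\otimes a_m)\diamond b_0=a_0b_0\otimes a_1\otimes\cdots\otimes a_m$, and, for $m,n\ge1$, $(a_0\otimes a_1\otimes\cdots\otimes a_m)\diamond(b_0\otimes b_1\otimes\cdots\otimes b_n)=a_0b_0\otimes\big((a_1\otimes\cdots\otimes a_m)\diamond(1\otimes b_1\otimes\cdots\otimes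 b_n)\big)+a_0b_0\otimes\big((1\otimes a_1\otimes\cdots\otimes a_m)\diamond(b_1\otimes\cdots\otimes b_n)\big)+\lambda\,a_0b_0\otimes\big((a_1\otimes\cdots\otimes a_m)\diamond(b_1\otimes\cdots\otimes b_n)\big)$ for $a_i,b_j\in A$; its Baxter operator is $P_A(a_1\otimes\cdots\otimes a_m)=1\otimes a_1\otimes\cdots\otimes a_m$. The identity is $1\in A=A^{\otimes1}$. Here $\lambda=1$, and $a^p$ denotes the $p$-th power for this product. *)

(* Defs.v *)
From HB Require Import structures.
From mathcomp Require Import all_boot all_algebra.
From mathcomp Require Import boolp.

Set Implicit Arguments.
Unset Strict Implicit.
Unset Printing Implicit Defensive.

Import GRing.Theory.
Local Open Scope ring_scope.
Local Open Scope quotient_scope.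

Definition congr_modp (B : pzRingType) (p : nat) (a b : B) : Prop :=
  exists c : B, a - b = p%:R * c.

Definition is_baxter_operator (C : pzRingType) (R : pzRingType)
    (scale : C -> R -> R) (lam : C) (P : R -> R) : Prop :=
  (forall (k : C) (x y : R), P (scale k x + y) = scale k (P x) + P y) /\
  (forall x y : R, P x * P y = P (x * P y) + P (P x * y) + scale lam (P (x * y))).

Lemma baxter_assoc_step (C : pzRingType) (M : lmodType C) (lam : C)
    (op : M -> M -> M) (Q : M -> M) :
    left_distributive op +%R -> right_distributive op +%R ->
    (forall k x y, op (k *: x) y = k *: op x y) ->
    (forall k x y, op x (k *: y) = k *: op x y) ->
    (forall x y, Q (x + y) = Q x + Q y) -> (forall k x, Q (k *: x) = k *: Q x) ->
    (forall x y, op (Q x) (Q y) = Q (op x (Q y)) + Q (op (Q x) y) + lam *: Q (op x y)) ->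
  forall x y z,
    op x (op (Q y) (Q z)) = op (op x (Q y)) (Q z) ->
    op (Q x) (op y (Q z)) = op (op (Q x) y) (Q z) ->
    op x (op y (Q z)) = op (op x y) (Q z) ->
    op (Q x) (op (Q y) z) = op (op (Q x) (Q y)) z ->
    op x (op (Q y) z) = op (op x (Q y)) z ->
    op (Q x) (op y z) = op (op (Q x) y) z ->
    op x (op y z) = op (op x y) z ->
  op (Q x) (op (Q y) (Q z)) = op (op (Q x) (Q y)) (Q z).
Proof.
move=> opDl opDr opZl opZr QD QZ QB x y z E1 E2 E3 E4 E5 E6 E7.
have -> : op (Q x) (op (Q y) (Q z)) =
    Q (op x (op (Q y) (Q z)))
    + (Q (op (Q x) (op y (Q z))) + lam *: Q (op x (op y (Q z))))
    + (Q (op (Q x) (op (Q y) z)) + lam *: Q (op x (op (Q y) z)))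
    + (lam *: Q (op (Q x) (op y z)) + lam *: (lam *: Q (op x (op y z)))).
  rewrite (QB y) !(opDr, opZr, QB x, QD, QZ, scalerDr).
  by rewrite [LHS](AC (3*3*3) ((1*4*7)*(2*3)*(5*6)*(8*9))).
have -> : op (op (Q x) (Q y)) (Q z) =
    Q (op (op (Q x) (Q y)) z)
    + (Q (op (op x (Q y)) (Q z)) + lam *: Q (op (op x (Q y)) z))
    + (Q (op (op (Q x) y) (Q z)) + lam *: Q (op (op (Q x) y) z))
    + (lam *: Q (op (op x y) (Q z)) + lam *: (lam *: Q (op (op x y) z))).
  rewrite (QB x y) !(opDl, opZl, QB _ z, QD, QZ, scalerDr).
  by rewrite [LHS](AC (3*3*3) ((2*5*8)*(1*3)*(4*6)*(7*9))).
rewrite E1 E2 E3 E4 E5 E6 E7.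
by rewrite [LHS](AC (1*2*2*2) (4*(1*5)*(2*6)*(3*7))).
Qed.

(* A commutative C-algebra A is given by its structure morphism f : C -> A, so  *)
(* that c in C acts on A by multiplication by f c; the zero ring is allowed     *)
(* both for C and for A.                                                        *)

Section Tensors.
Variables (C A : comPzRingType) (f : {rmorphism C -> A}).

(* The pure tensor a_0 (x) a_1 (x) ... (x) a_n is encoded by (a_0, [a_1..a_n]). *)
Definition word : Type := (A * seq A)%type.
HB.instance Definition _ := Choice.on word.

Definition slot (u : seq A) (a : A) (v : seq A) : word :=
  if u is x :: u' then (x, u' ++ a :: v) else (a, v).

Definition formal : Type := seq (C * word).
HB.instance Definition _ := Choice.on formal.

(* The congruence presenting the direct sum of the A^{(x) n}, n >= 1, as the    *)
(* C-module generated by the words of length n >= 1, modulo C-multilinearity in *)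
(* every letter; a list of pairs (c, w) stands for the sum of the c w.          *)
Inductive tensor_eq : formal -> formal -> Prop :=
| teq_refl s : tensor_eq s s
| teq_sym s t : tensor_eq s t -> tensor_eq t s
| teq_trans s t r : tensor_eq s t -> tensor_eq t r -> tensor_eq s r
| teq_cat s s' t t' :
    tensor_eq s s' -> tensor_eq t t' -> tensor_eq (s ++ t) (s' ++ t')
| teq_catC s t : tensor_eq (s ++ t) (t ++ s)
| teq_coef0 w : tensor_eq [:: (0, w)] [::]
| teq_coefD c d w : tensor_eq [:: (c + d, w)] [:: (c, w); (d, w)]
| teq_add c u a b v :
    tensor_eq [:: (c, slot u (a + b) v)] [:: (c, slot u a v); (c, slot u b v)]
| teq_scale c k u a v :
    tensor_eq [:: (c, slot u (f k * a) v)] [:: (c * k, slot u a v)].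

Definition tensor_eqb (s t : formal) : bool := `[< tensor_eq s t >].

Lemma tensor_eqb_equiv : equiv_class_of tensor_eqb.
Proof.
split=> [s | s t | t s r].
- exact/asboolP/teq_refl.
- by apply/asboolP/asboolP => /teq_sym.
- by move=> /asboolP st /asboolP tr; apply/asboolP; exact: teq_trans st tr.
Qed.

Canonical tensor_equiv := EquivRelPack tensor_eqb_equiv.

Definition tensors : Type := {eq_quot tensor_equiv}.
HB.instance Definition _ := Choice.on tensors.
HB.instance Definition _ := Quotient.on tensors.

Definition tcls (s : formal) : tensors := \pi_tensors s.

Lemma tclsP s t : tensor_eq s t <-> tcls s = tcls t.
Proof.
split=> [st | /eqquotP /asboolP //].
by apply/eqquotP/asboolP.
Qed.

Lemma repr_tcls s : tensor_eq (repr (tcls s)) s.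
Proof. by apply/tclsP; rewrite /tcls reprK. Qed.

Lemma tcls_repr x : tcls (repr x) = x.
Proof. exact: reprK. Qed.

Definition fscale (k : C) (s : formal) : formal := [seq (k * cw.1, cw.2) | cw <- s].

Lemma fscale_eq k s t : tensor_eq s t -> tensor_eq (fscale k s) (fscale k t).
Proof.
elim=> {s t} /=; try by move=> *; constructor.
- by move=> s t r _ st _ tr; exact: teq_trans st tr.
- by move=> s s' t t' _ ss' _ tt'; rewrite /fscale !map_cat; exact: teq_cat.
- by move=> s t; rewrite /fscale !map_cat; exact: teq_catC.
- by move=> w; rewrite mulr0; exact: teq_coef0.
- by move=> c d w; rewrite mulrDr; exact: teq_coefD.
- by move=> c l u a v; rewrite mulrA; exact: teq_scale.
Qed.

Definition tadd (x y : tensors) : tensors := tcls (repr x ++ repr y).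
Definition tscale (k : C) (x : tensors) : tensors := tcls (fscale k (repr x)).
Definition tzero : tensors := tcls [::].
Definition topp (x : tensors) : tensors := tscale (-1) x.

Lemma taddE s t : tadd (tcls s) (tcls t) = tcls (s ++ t).
Proof. by apply/tclsP/teq_cat; exact: repr_tcls. Qed.

Lemma tscaleE k s : tscale k (tcls s) = tcls (fscale k s).
Proof. exact/tclsP/fscale_eq/repr_tcls. Qed.

Lemma taddA : associative tadd.
Proof.
by move=> x y z; rewrite -(tcls_repr x) -(tcls_repr y) -(tcls_repr z) !taddE catA.
Qed.

Lemma taddC : commutative tadd.
Proof.
move=> x y; rewrite -(tcls_repr x) -(tcls_repr y) !taddE.
exact/tclsP/teq_catC.
Qed.

Lemma tadd0 : left_id tzero tadd.
Proof. by move=> x; rewrite -(tcls_repr x) taddE. Qed.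

Lemma tscaleD2 x : {morph tscale^~ x : k l / k + l >-> tadd k l}.
Proof.
move=> k l; rewrite -(tcls_repr x) !tscaleE taddE; apply/tclsP.
elim: (repr x) => [|[c w] s IHs] /=; first exact: teq_refl.
rewrite mulrDl -[_ :: fscale _ s]cat1s.
apply: (teq_trans (teq_cat (teq_coefD _ _ _) IHs)) => /=.
rewrite -[_ :: _ :: _]cat1s -[X in tensor_eq _ X]cat1s.
apply: teq_cat; first exact: teq_refl.
rewrite -[X in tensor_eq X _]cat1s -[(l * c, w) :: fscale l s]cat1s !catA.
by apply: teq_cat; [exact: teq_catC | exact: teq_refl].
Qed.

Lemma tscale0 x : tscale 0 x = tzero.
Proof.
rewrite -(tcls_repr x) !tscaleE; apply/tclsP.
elim: (repr x) => [|[c w] s IHs] /=; first exact: teq_refl.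
by rewrite mul0r -cat1s -[X in tensor_eq _ X]cat0s; apply: teq_cat => //; exact: teq_coef0.
Qed.

Lemma tscale1 : left_id 1 tscale.
Proof.
move=> x; rewrite -{1}(tcls_repr x) tscaleE -[RHS]tcls_repr; congr tcls.
by rewrite -[RHS]map_id; apply: eq_map => -[c w] /=; rewrite mul1r.
Qed.

Lemma taddN : left_inverse tzero topp tadd.
Proof.
by move=> x; rewrite /topp -{2}(tscale1 x) -tscaleD2 addNr tscale0.
Qed.

HB.instance Definition _ := GRing.isZmodule.Build tensors taddA taddC tadd0 taddN.

Lemma tscaleA k l x : tscale k (tscale l x) = tscale (k * l) x.
Proof.
rewrite -(tcls_repr x) !tscaleE; congr tcls; rewrite /fscale -map_comp.
by apply: eq_map => -[c w] /=; rewrite mulrA.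
Qed.

Lemma tscaleDr : right_distributive tscale +%R.
Proof.
move=> k x y; rewrite -(tcls_repr x) -(tcls_repr y) [_ + _]taddE !tscaleE.
by rewrite [_ + _]taddE /fscale map_cat.
Qed.

HB.instance Definition _ :=
  GRing.Zmodule_isLmodule.Build C tensors tscaleA tscale1 tscaleDr tscaleD2.

(* The pure tensor a_0 (x) a_1 (x) ... (x) a_n, with u = [a_1..a_n]. *)
Definition tens (a0 : A) (u : seq A) : tensors := tcls [:: (1, (a0, u))].
Definition wtens (w : word) : tensors := tens w.1 w.2.

Lemma tcls_cat s t : tcls (s ++ t) = tcls s + tcls t.
Proof. by rewrite -taddE. Qed.

Lemma tcls1 c w : tcls [:: (c, w)] = c *: wtens w.
Proof. by case: w => a u; rewrite [RHS]tscaleE /= mulr1. Qed.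

Lemma tcls_sum s : tcls s = \sum_(cw <- s) cw.1 *: wtens cw.2.
Proof.
elim: s => [|[c w] s IHs]; first by rewrite big_nil.
by rewrite big_cons -IHs -cat1s tcls_cat tcls1.
Qed.

Definition multilinear (M : lmodType C) (g : word -> M) : Prop :=
  forall k u a b v, g (slot u (f k * a + b) v) = k *: g (slot u a v) + g (slot u b v).

Lemma wtens_multilinear : multilinear wtens.
Proof.
move=> k u a b v; rewrite -[LHS]scale1r -tcls1.
have /tclsP -> := teq_add 1 u (f k * a) b v.
rewrite -cat1s tcls_cat [X in _ + X]tcls1 scale1r; congr (_ + _).
have /tclsP -> := teq_scale 1 k u a v.
by rewrite tcls1 mul1r.
Qed.

Lemma tens_linl k a b u : tens (f k * a + b) u = k *: tens a u + tens b u.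
Proof. exact: (wtens_multilinear k [::]). Qed.

Lemma tens_ind (P : tensors -> Prop) :
    P 0 -> (forall x y, P x -> P y -> P (x + y)) -> (forall k x, P x -> P (k *: x)) ->
  (forall a u, P (tens a u)) -> forall x, P x.
Proof.
move=> P0 PD PZ Pt x; rewrite -(tcls_repr x) tcls_sum.
by elim/big_ind: _ => // cw _; apply: PZ; exact: Pt.
Qed.

(* The C-linear extension of a multilinear map on words. *)
Definition tlift (M : lmodType C) (g : word -> M) (x : tensors) : M :=
  \sum_(cw <- repr x) cw.1 *: g cw.2.

Section Lift.
Variables (M : lmodType C) (g : word -> M).
Hypothesis gM : multilinear g.

Lemma multilinearD u a b v : g (slot u (a + b) v) = g (slot u a v) + g (slot u b v).
Proof. by have := gM 1 u a b v; rewrite rmorph1 mul1r scale1r. Qed.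

Lemma multilinearZ k u a v : g (slot u (f k * a) v) = k *: g (slot u a v).
Proof.
have g0 : g (slot u 0 v) = 0.
  by apply: (@addrI _ (g (slot u 0 v))); rewrite -multilinearD !addr0.
by have := gM k u a 0 v; rewrite g0 !addr0.
Qed.

Lemma tlift_cls s : tlift g (tcls s) = \sum_(cw <- s) cw.1 *: g cw.2.
Proof.
have E t t' : tensor_eq t t' ->
    \sum_(cw <- t) cw.1 *: g cw.2 = \sum_(cw <- t') cw.1 *: g cw.2.
  elim=> {t t'} //.
  - by move=> t t' r _ -> _ ->.
  - by move=> t1 t1' t2 t2' _ IH1 _ IH2; rewrite !big_cat /= IH1 IH2.
  - by move=> t t'; rewrite !big_cat /= addrC.
  - by move=> w; rewrite big_seq1 big_nil scale0r.
  - by move=> c d w; rewrite big_seq1 !big_cons big_nil addr0 scalerDl.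
  - by move=> c u a b v; rewrite big_seq1 !big_cons big_nil addr0 multilinearD scalerDr.
  - by move=> c k u a v; rewrite !big_seq1 multilinearZ scalerA.
exact: E (repr_tcls s).
Qed.

Lemma tlift_lin k x y : tlift g (k *: x + y) = k *: tlift g x + tlift g y.
Proof.
rewrite -(tcls_repr x) -(tcls_repr y) [_ *: _]tscaleE -tcls_cat !tlift_cls.
rewrite big_cat big_map scaler_sumr; congr (_ + _).
by apply: eq_bigr => cw _; rewrite scalerA.
Qed.

Lemma tlift_tens a u : tlift g (tens a u) = g (a, u).
Proof. by rewrite tlift_cls big_seq1 scale1r. Qed.

End Lift.

(* a (x) x, sending the pure tensor b_0 (x) ... (x) b_n to                      *)
(* a (x) b_0 (x) ... (x) b_n.                                                   *)
Definition tcons (a : A) : tensors -> tensors :=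
  tlift (fun w => tens a (w.1 :: w.2)).

Lemma slot_cons a u b v : (a, (slot u b v).1 :: (slot u b v).2) = slot (a :: u) b v.
Proof. by case: u. Qed.

Lemma tcons_multilinear a : multilinear (fun w => tens a (w.1 :: w.2)).
Proof.
move=> k u b c v.
rewrite -![tens _ _]/(wtens (_, _)) !slot_cons.
exact: wtens_multilinear.
Qed.

Lemma tcons_tens a b v : tcons a (tens b v) = tens a (b :: v).
Proof. exact: (tlift_tens (tcons_multilinear a)). Qed.

Lemma tcons_lin a k x y : tcons a (k *: x + y) = k *: tcons a x + tcons a y.
Proof. exact: (tlift_lin (tcons_multilinear a)). Qed.

Lemma tcons_linl k a b x : tcons (f k * a + b) x = k *: tcons a x + tcons b x.
Proof.
rewrite /tcons /tlift scaler_sumr -big_split /=; apply: eq_bigr => cw _.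
by rewrite tens_linl scalerDr !scalerA mulrC.
Qed.

Section Product.
Variable lam : C.

(* The product (a_0 (x) ... (x) a_m) <> (b_0 (x) ... (x) b_n) of pure tensors,  *)
(* with u = [a_1..a_m] and v = [b_1..b_n], by the recursion defining the        *)
(* mixable shuffle product of weight lam.                                       *)
Fixpoint wdiamond (a0 : A) (u : seq A) (b0 : A) (v : seq A) {struct u} : tensors :=
  if u is a1 :: u' then
    (fix aux (a0 b0 : A) (v : seq A) {struct v} : tensors :=
       if v is b1 :: v' then
         tcons (a0 * b0) (wdiamond a1 u' 1 (b1 :: v'))
         + tcons (a0 * b0) (aux 1 b1 v')
         + lam *: tcons (a0 * b0) (wdiamond a1 u' b1 v')
       else tens (a0 * b0) u) a0 b0 v
  else tens (a0 * b0) v.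

Lemma wdiamond0l a0 b0 v : wdiamond a0 [::] b0 v = tens (a0 * b0) v.
Proof. by []. Qed.

Lemma wdiamond0r a0 u b0 : wdiamond a0 u b0 [::] = tens (a0 * b0) u.
Proof. by case: u. Qed.

Lemma wdiamond_cons a0 a1 u b0 b1 v :
  wdiamond a0 (a1 :: u) b0 (b1 :: v) =
    tcons (a0 * b0) (wdiamond a1 u 1 (b1 :: v))
    + tcons (a0 * b0) (wdiamond 1 (a1 :: u) b1 v)
    + lam *: tcons (a0 * b0) (wdiamond a1 u b1 v).
Proof. by []. Qed.

Lemma wdiamondC a u b v : wdiamond a u b v = wdiamond b v a u.
Proof.
elim: u a b v => [|a1 u IHu] a b v; first by rewrite wdiamond0r mulrC.
elim: v a b => [|b1 v IHv] a b; first by rewrite wdiamond0r mulrC.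
rewrite !wdiamond_cons !(IHu a1) IHv (mulrC b).
by congr (_ + _); rewrite addrC.
Qed.

Lemma wdiamond_linh k a a' u b v :
  wdiamond (f k * a + a') u b v = k *: wdiamond a u b v + wdiamond a' u b v.
Proof.
have E : (f k * a + a') * b = f k * (a * b) + a' * b by rewrite mulrDl mulrA.
case: u => [|a1 u]; first by rewrite !wdiamond0l E tens_linl.
case: v => [|b1 v]; first by rewrite !wdiamond0r E tens_linl.
rewrite !wdiamond_cons E !tcons_linl !scalerDr !scalerA (mulrC lam k).
by rewrite [LHS](AC (2*2*2) ((1*3*5)*(2*4*6))).
Qed.

Lemma wdiamond_lint k a u x y u' b v :
  wdiamond a (u ++ (f k * x + y) :: u') b v =
    k *: wdiamond a (u ++ x :: u') b v + wdiamond a (u ++ y :: u') b v.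
Proof.
have comb c (x1 x2 x3 y1 y2 y3 : tensors) :
    tcons c (k *: x1 + y1) + tcons c (k *: x2 + y2) + lam *: tcons c (k *: x3 + y3)
    = k *: (tcons c x1 + tcons c x2 + lam *: tcons c x3)
      + (tcons c y1 + tcons c y2 + lam *: tcons c y3).
  rewrite !tcons_lin !scalerDr !scalerA (mulrC lam k).
  by rewrite [LHS](AC (2*2*2) ((1*3*5)*(2*4*6))).
have nilcase w c d : wdiamond c (w ++ (f k * x + y) :: u') d [::] =
    k *: wdiamond c (w ++ x :: u') d [::] + wdiamond c (w ++ y :: u') d [::].
  by rewrite !wdiamond0r; exact: (wtens_multilinear k (c * d :: w)).
elim: u a b v => [|a1 u IHu] a b v.
  elim: v a b => [|b1 v IHv] a b; first exact: (nilcase [::]).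
  by rewrite !wdiamond_cons !wdiamond_linh (IHv 1 b1) comb.
elim: v a b => [|b1 v IHv] a b; first exact: nilcase.
by rewrite !cat_cons !wdiamond_cons !IHu (IHv 1 b1) comb.
Qed.

Lemma wdiamond_multilinear b v : multilinear (fun w => wdiamond w.1 w.2 b v).
Proof.
move=> k [|a u] x y u' /=; first exact: wdiamond_linh.
exact: wdiamond_lint.
Qed.

Lemma wdiamond_multilinearr a u : multilinear (fun w => wdiamond a u w.1 w.2).
Proof.
move=> k v x y v' /=; rewrite !(wdiamondC a u).
exact: wdiamond_multilinear.
Qed.

Definition diamond (x y : tensors) : tensors :=
  tlift (fun w => tlift (fun w' => wdiamond w.1 w.2 w'.1 w'.2) y) x.

Lemma diamond_multilinear y :
  multilinear (fun w => tlift (fun w' => wdiamond w.1 w.2 w'.1 w'.2) y).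
Proof.
move=> k u a b v /=; rewrite /tlift scaler_sumr -big_split /=.
apply: eq_bigr => cw _; have /= -> := wdiamond_multilinear cw.2.1 cw.2.2 k u a b v.
by rewrite scalerDr !scalerA mulrC.
Qed.

Lemma diamond_tens a u b v : diamond (tens a u) (tens b v) = wdiamond a u b v.
Proof.
rewrite /diamond (tlift_tens (diamond_multilinear _)).
exact: (tlift_tens (wdiamond_multilinearr a u)).
Qed.

Lemma diamond_linl k x y z : diamond (k *: x + y) z = k *: diamond x z + diamond y z.
Proof. exact: (tlift_lin (diamond_multilinear z)). Qed.

Lemma diamond_linr k x y z : diamond z (k *: x + y) = k *: diamond z x + diamond z y.
Proof.
have E t : diamond z t =
  \sum_(cw <- repr z) cw.1 *: tlift (fun w => wdiamond cw.2.1 cw.2.2 w.1 w.2) t by [].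
rewrite !E scaler_sumr -big_split /=.
apply: eq_bigr => cw _; rewrite (tlift_lin (wdiamond_multilinearr _ _)).
by rewrite scalerDr !scalerA mulrC.
Qed.

Lemma diamondDl : left_distributive diamond +%R.
Proof. by move=> x y z; have := diamond_linl 1 x y z; rewrite !scale1r. Qed.

Lemma diamondDr : right_distributive diamond +%R.
Proof. by move=> x y z; have := diamond_linr 1 y z x; rewrite !scale1r. Qed.

Lemma diamond0l x : diamond 0 x = 0.
Proof. by apply: (@addrI _ (diamond 0 x)); rewrite -diamondDl !addr0. Qed.

Lemma diamond0r x : diamond x 0 = 0.
Proof. by apply: (@addrI _ (diamond x 0)); rewrite -diamondDr !addr0. Qed.

Lemma diamondZl k x y : diamond (k *: x) y = k *: diamond x y.
Proof. by have := diamond_linl k x 0 y; rewrite diamond0l !addr0. Qed.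

Lemma diamondZr k x y : diamond x (k *: y) = k *: diamond x y.
Proof. by have := diamond_linr k y 0 x; rewrite diamond0r !addr0. Qed.

Lemma tconsD a x y : tcons a (x + y) = tcons a x + tcons a y.
Proof. by have := tcons_lin a 1 x y; rewrite !scale1r. Qed.

Lemma tcons0 a : tcons a 0 = 0.
Proof. by apply: (@addrI _ (tcons a 0)); rewrite -tconsD !addr0. Qed.

Lemma tconsZ a k x : tcons a (k *: x) = k *: tcons a x.
Proof. by have := tcons_lin a k x 0; rewrite tcons0 !addr0. Qed.

Lemma diamondC : commutative diamond.
Proof.
move=> x y; elim/tens_ind: x => [|x x' IHx IHx'|k x IHx|a u].
- by rewrite diamond0l diamond0r.
- by rewrite diamondDl diamondDr IHx IHx'.
- by rewrite diamondZl diamondZr IHx.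
elim/tens_ind: y => [|y y' IHy IHy'|k y IHy|b v].
- by rewrite diamond0l diamond0r.
- by rewrite diamondDl diamondDr IHy IHy'.
- by rewrite diamondZl diamondZr IHy.
by rewrite !diamond_tens wdiamondC.
Qed.

Lemma diamond1 : left_id (tens 1 [::]) diamond.
Proof.
elim/tens_ind=> [|x x' IHx IHx'|k x IHx|a u].
- by rewrite diamond0r.
- by rewrite diamondDr IHx IHx'.
- by rewrite diamondZr IHx.
by rewrite diamond_tens wdiamond0l mul1r.
Qed.

Lemma diamond_headcons a b x : diamond (tens a [::]) (tcons b x) = tcons (a * b) x.
Proof.
elim/tens_ind: x => [|x x' IHx IHx'|k x IHx|c u].
- by rewrite !tcons0 diamond0r.
- by rewrite !tconsD diamondDr IHx IHx'.
- by rewrite !tconsZ diamondZr IHx.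
by rewrite !tcons_tens diamond_tens wdiamond0l.
Qed.

Lemma diamond_head a x y :
  diamond (diamond (tens a [::]) x) y = diamond (tens a [::]) (diamond x y).
Proof.
elim/tens_ind: x => [|x x' IHx IHx'|k x IHx|b u].
- by rewrite !(diamond0l, diamond0r).
- by rewrite !(diamondDl, diamondDr) IHx IHx'.
- by rewrite !(diamondZl, diamondZr) IHx.
elim/tens_ind: y => [|y y' IHy IHy'|k y IHy|c v].
- by rewrite !(diamond0l, diamond0r).
- by rewrite !(diamondDl, diamondDr) IHy IHy'.
- by rewrite !(diamondZl, diamondZr) IHy.
rewrite (diamond_tens a) wdiamond0l !diamond_tens.
case: u => [|b1 u]; first by rewrite !wdiamond0l diamond_tens wdiamond0l mulrA.
case: v => [|c1 v]; first by rewrite !wdiamond0r diamond_tens wdiamond0l mulrA.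
by rewrite !wdiamond_cons !(diamondDr, diamondZr) !diamond_headcons mulrA.
Qed.

Lemma diamond_baxter x y :
  diamond (tcons 1 x) (tcons 1 y) =
    tcons 1 (diamond x (tcons 1 y)) + tcons 1 (diamond (tcons 1 x) y)
    + lam *: tcons 1 (diamond x y).
Proof.
elim/tens_ind: x => [|x x' IHx IHx'|k x IHx|a u].
- by rewrite !(tcons0, diamond0l) scaler0 !addr0.
- rewrite !(tconsD, diamondDl) IHx IHx' scalerDr.
  by rewrite [LHS](AC (3*3) ((1*4)*(2*5)*(3*6))).
- by rewrite !(tconsZ, diamondZl) IHx !scalerDr !scalerA (mulrC lam).
elim/tens_ind: y => [|y y' IHy IHy'|k y IHy|b v].
- by rewrite !(tcons0, diamond0r) scaler0 !addr0.
- rewrite !(tconsD, diamondDr) IHy IHy' scalerDr.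
  by rewrite [LHS](AC (3*3) ((1*4)*(2*5)*(3*6))).
- by rewrite !(tconsZ, diamondZr) IHy !scalerDr !scalerA (mulrC lam).
by rewrite !tcons_tens !diamond_tens wdiamond_cons mulr1.
Qed.

Lemma diamondA_tens a u b v c w :
  diamond (tens a u) (diamond (tens b v) (tens c w)) =
  diamond (diamond (tens a u) (tens b v)) (tens c w).
Proof.
have [n] := ubnP (size u + size v + size w)%N.
elim: n a u b v c w => // n IHn a u b v c w; rewrite ltnS => le_n.
have hdr d x y :
    diamond x (diamond (tens d [::]) y) = diamond (tens d [::]) (diamond x y).
  by rewrite diamondC diamond_head (diamondC y).
case: u le_n => [|a1 u] le_n; first by rewrite diamond_head.
case: v le_n => [|b1 v] le_n.
  have {1}-> : tens b [::] = diamond (tens b [::]) (tens 1 [::]).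
    by rewrite diamond_tens wdiamond0l mulr1.
  by rewrite diamond_head diamond1 hdr (diamondC _ (tens b _)) diamond_head.
case: w le_n => [|c1 w] le_n.
  by rewrite (diamondC _ (tens c _)) hdr (diamondC _ (tens c _)).
have hd d d1 t : tens d (d1 :: t) = diamond (tens d [::]) (tcons 1 (tens d1 t)).
  by rewrite tcons_tens diamond_tens wdiamond0l mulr1.
have hh d e x y : diamond (diamond (tens d [::]) x) (diamond (tens e [::]) y) =
    diamond (tens (d * e) [::]) (diamond x y).
  by rewrite diamond_head hdr -diamond_head diamond_tens wdiamond0l.
rewrite (hd a) (hd b) (hd c) !hh mulrA; congr (diamond _ _).
apply: (baxter_assoc_step diamondDl diamondDr diamondZl diamondZr (@tconsD _)
          (@tconsZ _) diamond_baxter); rewrite ?tcons_tens; apply: IHn;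
  by apply: leq_trans le_n; rewrite /= !(addSn, addnS);
  do ?[exact: leqnn | apply: leqW].
Qed.

Lemma diamondA : associative diamond.
Proof.
move=> x y z.
elim/tens_ind: x => [|x x' IHx IHx'|k x IHx|a u].
- by rewrite !diamond0l.
- by rewrite !diamondDl IHx IHx'.
- by rewrite !diamondZl IHx.
elim/tens_ind: y => [|y y' IHy IHy'|k y IHy|b v].
- by rewrite !(diamond0l, diamond0r).
- by rewrite !(diamondDl, diamondDr) IHy IHy'.
- by rewrite !(diamondZl, diamondZr) IHy.
elim/tens_ind: z => [|z z' IHz IHz'|k z IHz|c w].
- by rewrite !diamond0r.
- by rewrite !diamondDr IHz IHz'.
- by rewrite !diamondZr IHz.
exact: diamondA_tens.
Qed.

End Product.
End Tensors.

(* The free Baxter C-algebra of weight lam on A: the tensors above, with the    *)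
(* mixable shuffle product of weight lam; its identity is the tensor 1 of       *)
(* length one.                                                                  *)
Definition mixshuffle (C A : comPzRingType) (f : {rmorphism C -> A}) (lam : C) : Type :=
  tensors f.

Section MixableShuffle.
Variables (C A : comPzRingType) (f : {rmorphism C -> A}) (lam : C).

HB.instance Definition _ := GRing.Lmodule.on (mixshuffle f lam).
HB.instance Definition _ := GRing.Zmodule_isComPzRing.Build (mixshuffle f lam)
  (diamondA lam) (diamondC lam) (diamond1 lam) (diamondDl lam).

Lemma mixshuffle_scalerAl (k : C) (x y : mixshuffle f lam) :
  k *: (x * y) = (k *: x) * y.
Proof. by rewrite [RHS]diamondZl. Qed.

Definition baxter_op : mixshuffle f lam -> mixshuffle f lam := @tcons C A f 1.

Lemma baxter_opE (a : A) (u : seq A) : baxter_op (tens f a u) = tens f 1 (a :: u).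
Proof. exact: tcons_tens. Qed.

Lemma mixshuffle_baxter :
  @is_baxter_operator C (mixshuffle f lam) *:%R lam baxter_op.
Proof. by split=> [k x y | x y]; [exact: tcons_lin | exact: diamond_baxter]. Qed.

End MixableShuffle.

(* Main.v *)
(** The map [x |-> x^p] is additive modulo [p], and every element of the free
    Baxter algebra is a sum of pure tensors [a ⋄ P y] with [y] a shorter pure
    tensor, so by induction on length it suffices to pass from [y^p = y] to
    [(P y)^p = P y] modulo [p].  For weight 1 the Baxter identity reads
    [P x P y = P ((P x + x)(P y + y) - P x P y)]; hence, as for partial sums
    (where [P x + x] is the shift of [P x]), [(P y)^n = P ((P y + y)^n - (P y)^n)]
    for [n >= 1].  At [n = p] the argument of the outer [P] is [y^p = y] modulo [p]. *)

Require Import Defs.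
From mathcomp Require Import all_boot all_algebra finfield.

Set Implicit Arguments.
Unset Strict Implicit.
Unset Printing Implicit Defensive.

Import GRing.Theory.
Local Open Scope ring_scope.

Section Congruence.
Variables (B : comPzRingType) (p : nat).
Implicit Types a b c d : B.

Lemma congr_modp_refl a : congr_modp p a a.
Proof. by exists 0; rewrite subrr mulr0. Qed.

Lemma congr_modp_trans b a c :
  congr_modp p a b -> congr_modp p b c -> congr_modp p a c.
Proof. by move=> [d E] [e F]; exists (d + e); rewrite mulrDr -E -F addrA subrK. Qed.

Lemma congr_modpD a b c d :
  congr_modp p a b -> congr_modp p c d -> congr_modp p (a + c) (b + d).
Proof.
by move=> [x E] [y F]; exists (x + y); rewrite mulrDr -E -F opprD addrACA.
Qed.

Lemma congr_modpM a b c d :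
  congr_modp p a b -> congr_modp p c d -> congr_modp p (a * c) (b * d).
Proof.
(* The witness comes from [a * c - b * d = (a - b) * c + b * (c - d)]. *)
move=> [x E] [y F]; exists (x * c + b * y).
by rewrite mulrDr mulrA -E mulrCA -F mulrBl mulrBr addrA subrK.
Qed.

End Congruence.

(** The prime [p] divides every binomial coefficient strictly between the two ends of the
    expansion. *)
Lemma congr_modp_exprD (B : comPzRingType) (p : nat) (p_prime : prime p) (a b : B) :
  congr_modp p ((a + b) ^+ p) (a ^+ p + b ^+ p).
Proof.
have p_gt0 := prime_gt0 p_prime.
case: p p_prime p_gt0 => // q q_prime _.
rewrite exprDn big_ord_recl big_ord_recr /= /bump !leq0n !add1n !(subn0, subnn, bin0, binn) !expr0.
rewrite mulr1 mul1r !mulr1n addrA -[X in congr_modp _ _ (X + _)]addr0.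
apply: congr_modpD; last exact: congr_modp_refl.
apply: congr_modpD; first exact: congr_modp_refl.
elim/big_ind: _ => [|x y|i _]; first exact: congr_modp_refl.
  by move=> Hx Hy; rewrite -[0]addr0; exact: congr_modpD.
have /dvdnP[k ->] : (q.+1 %| 'C(q.+1, i.+1))%N.
  by apply: prime_dvd_bin => //=; rewrite ltnS; exact: ltn_ord.
by exists (a ^+ (q.+1 - i.+1) * b ^+ i.+1 *+ k); rewrite subr0 mulrnA mulr_natl.
Qed.

Section BaxterPower.
Variables (C : pzRingType) (B : comPzRingType) (scale : C -> B -> B) (P : B -> B).
Hypothesis scale1 : forall x, scale 1 x = x.
Hypothesis baxterP : is_baxter_operator scale 1 P.

Lemma baxter_additive x y : P (x + y) = P x + P y.
Proof. by have := baxterP.1 1 x y; rewrite !scale1. Qed.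

Lemma baxter0 : P 0 = 0.
Proof. by apply: (@addrI _ (P 0)); rewrite -baxter_additive !addr0. Qed.

Lemma baxter_opp x : P (- x) = - P x.
Proof.
by apply: (@addrI _ (P x)); rewrite -baxter_additive !subrr baxter0.
Qed.

(** A multiple by the natural number [p] is an iterated sum, so additivity gives
    [P (p c) = p P c]. *)
Lemma congr_modp_baxter p x y :
  congr_modp p x y -> congr_modp p (P x) (P y).
Proof.
move=> [c E]; exists (P c); rewrite -baxter_opp -baxter_additive E.
rewrite !mulr_natl; elim: p {E} => [|n IHn]; first by rewrite !mulr0n baxter0.
by rewrite !mulrS baxter_additive IHn.
Qed.

Lemma baxter_mul x y : P x * P y = P ((P x + x) * (P y + y) - P x * P y).
Proof.
rewrite [LHS]baxterP.2 scale1 -!baxter_additive; congr P.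
by rewrite mulrDl !mulrDr -!addrA [RHS]addrC !addrA subrK [x * P y + _]addrC.
Qed.

Lemma baxter_exp x n : P x ^+ n.+1 = P ((P x + x) ^+ n.+1 - P x ^+ n.+1).
Proof.
elim: n => [|n IHn]; first by rewrite !expr1 addrAC subrr add0r.
(* Let [y] be the argument of the outer [P] in [IHn]. Then [P y = P x ^+ n.+1], and [P y + y]
   telescopes to [(P x + x) ^+ n.+1]. *)
by rewrite [LHS]exprS IHn baxter_mul -IHn [P x ^+ n.+1 + _]addrC subrK -!exprS.
Qed.

Lemma congr_modp_baxter_exp p x (p_prime : prime p) :
  congr_modp p (x ^+ p) x -> congr_modp p (P x ^+ p) (P x).
Proof.
move=> xp; rewrite -(prednK (prime_gt0 p_prime)) baxter_exp (prednK (prime_gt0 p_prime)).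
apply: congr_modp_baxter.
have [c E] := congr_modp_exprD p_prime (P x) x.
(* Moving [P x ^+ p] to the left-hand side leaves the witness [c] unchanged. *)
by apply: congr_modp_trans xp; exists c; rewrite -E opprD addrA.
Qed.

End BaxterPower.

Section Mixshuffle.
Variables (C A : comPzRingType) (f : {rmorphism C -> A}) (p : nat).
Hypotheses (p_prime : prime p) (fermatA : forall a : A, congr_modp p (a ^+ p) a).
Local Notation Sh := (mixshuffle f 1).
Local Notation pure a u := (tens f a u : Sh).

Lemma pureM a b u : pure a [::] * pure b u = pure (a * b) u.
Proof. exact: diamond_tens. Qed.

Lemma pureD a b u : pure (a + b) u = pure a u + pure b u.
Proof. by have := tens_linl f 1 a b u; rewrite rmorph1 mul1r scale1r. Qed.

(** Absorbing scalars into the head letter makes every element a plain sum of pure tensors. *)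
Lemma pureZ k a u : k *: pure a u = pure (f k * a) u.
Proof.
have E0 : pure 0 u = 0 by apply: (@addrI _ (pure 0 u)); rewrite -pureD !addr0.
by have := tens_linl f k a 0 u; rewrite E0 !addr0.
Qed.

Lemma pureX a n : pure a [::] ^+ n = pure (a ^+ n) [::].
Proof. by elim: n => [|n IHn] //; rewrite !exprS IHn pureM. Qed.

Lemma congr_modp_pure a b : congr_modp p a b -> congr_modp p (pure a [::]) (pure b [::]).
Proof.
move=> [c E]; exists (pure c [::]).
have -> : a = b + p%:R * c by rewrite -E addrC subrK.
rewrite pureD addrAC subrr add0r !mulr_natl.
elim: p {E} => [|n IHn]; last by rewrite !mulrS pureD IHn.
by rewrite !mulr0n; have := pureZ 0 0 [::]; rewrite mulr0 scale0r.
Qed.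

Lemma pure_fermat a u : congr_modp p (pure a u ^+ p) (pure a u).
Proof.
have fermat0 b : congr_modp p (pure b [::] ^+ p) (pure b [::]).
  by rewrite pureX; exact: congr_modp_pure.
(* The head stays general: the induction hypothesis is used at the head [b] of the shorter
   tensor. *)
elim: u a => [|b u IHu] a; first exact: fermat0.
have -> : pure a (b :: u) = pure a [::] * baxter_op (pure b u).
  by rewrite baxter_opE pureM mulr1.
rewrite exprMn; apply: congr_modpM => //.
apply: (congr_modp_baxter_exp _ (mixshuffle_baxter f 1)) => //.
exact: scale1r.
Qed.

Lemma mixshuffle_fermat (x : Sh) : congr_modp p (x ^+ p) x.
Proof.
rewrite -(tcls_repr x) tcls_sum.
elim/big_ind: _ => [|y z Hy Hz|[k [a u]] _].
- by rewrite expr0n gtn_eqF ?prime_gt0 //; exact: congr_modp_refl.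
- exact: congr_modp_trans (congr_modp_exprD p_prime (y : Sh) z) (congr_modpD Hy Hz).
- rewrite /= pureZ; exact: pure_fermat.
Qed.

End Mixshuffle.

Theorem theorem1p2 (p : nat) (p_prime : prime p) :
  (forall (C A : comPzRingType) (f : {rmorphism C -> A}),
      (forall a : A, congr_modp p (a ^+ p) a) ->
      forall x : mixshuffle f 1, congr_modp p (x ^+ p) x)
  /\
  (forall x : mixshuffle (idfun : {rmorphism 'F_p -> 'F_p}) 1, x ^+ p = x).
Proof.
split=> [C A f fermatA x | x]; first exact: mixshuffle_fermat.
have fermatF (a : 'F_p) : congr_modp p (a ^+ p) a.
  (* Only the exponent is rewritten, since [p] also occurs in the type of [a]. *)
  by rewrite -[X in a ^+ X](card_Fp p_prime) expf_card; exact: congr_modp_refl.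
have [c /eqP] := mixshuffle_fermat (f := idfun) p_prime fermatF x.
(* Over ['F_p], the multiple [p c] is [c] scaled by the zero scalar, so the congruence is an
   equality. *)
by rewrite mulr_natl -scaler_nat pchar_Fp_0 // scale0r subr_eq0 => /eqP.
Qed.
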